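(* For all integers $m,k\geq 0$ and $n=2m+k$, $$\sum_{P\in\mathscr{M}_{n}^{m,k}}\prod_{i\geq1}t_i^{u_i(P)}\prod_{i\geq1}s_i^{h_i(P)} =\sum_{j=0}^{k}\sum_{\ell=j}^k(-1)^{\ell-j}\binom{\ell-1}{\ell-j}\binom{m+j}{j}\frac{\mathbf{P}_{m}^{(m+j+1)}\big(1!t_1,2!t_2,\ldots\big)}{(m+1)!}\cdot\frac{\ell!\,\mathbf{B}_{k,\ell}\big(1!s_1,2!s_2,\ldots\big)}{k!}.$$
   Context: A Motzkin path of length $n$ is a lattice path from $(0,0)$ to $(n,0)$ in $\mathbb{Z}\times\mathbb{Z}$ with steps $u=(1,1)$, $h=(1,0)$, $d=(1,-1)$ never passing below the $x$-axis. $\mathscr{M}_n^{m,k}$ is the set of Motzkin paths of length $n=2m+k$ with $m$ up-steps and $k$ horizontal steps. A $u$-segment (resp. $h$-segment) of $P$ is a maximal run of consecutive up-steps (resp. horizontal steps); $u_i(P)$, $h_i(P)$ are the numbers of $u$-segments, $h$-segments of length $i$. The $t_i,s_i$ are commuting indeterminates. The partial Bell polynomial is $\mathbf{B}_{n,r}(x_1,x_2,\ldots)=\sum \frac{n!}{r_1!\cdots r_n!}\prod_{i=1}^n\left(\frac{x_i}{i!}\right)^{r_i}$, summed over nonnegative integer solutions of $r_1+\cdots+r_n=r$, $r_1+2r_2+\cdots+nr_n=n$ (so $\mathbf{B}_{0,0}=1$ and $\mathbf{B}_{n,0}=0$ for $n\ge1$). For a complex number $\lambda$, the potential polynomials $\mathbf{P}_n^{(\lambda)}(f_1,f_2,\ldots)$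 are defined by $1+\sum_{n\geq1}\mathbf{P}_n^{(\lambda)}\frac{u^n}{n!}=\left(1+\sum_{n\ge1}f_n\frac{u^n}{n!}\right)^{\lambda}$, with $\mathbf{P}_0^{(\lambda)}=1$. Binomial coefficients with integer (possibly negative) upper index $a$ are $\binom{a}{b}=a(a-1)\cdots(a-b+1)/b!$ for $b\ge0$ and $0$ for $b<0$ (so $\binom{-1}{0}=1$). *)

(* Defs.v *)
From HB Require Import structures.
From mathcomp Require Import all_boot all_order all_algebra.

Set Implicit Arguments.
Unset Strict Implicit.
Unset Printing Implicit Defensive.

Import Order.TTheory GRing.Theory Num.Theory.
Local Open Scope ring_scope.

Inductive step := Up | Hor | Down.

Definition ord_of_step (s : step) : 'I_3 :=
  match s with
  | Up => @Ordinal 3 0 isT | Hor => @Ordinal 3 1 isT | Down => @Ordinal 3 2 isT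
  end.

Definition step_of_ord (i : 'I_3) : step :=
  match val i with 0 => Up | 1 => Hor | _ => Down end.

Lemma ord_of_stepK : cancel ord_of_step step_of_ord.
Proof. by case. Qed.

HB.instance Definition _ := Finite.copy step (can_type ord_of_stepK).

Definition step_vec (s : step) : int * int :=
  match s with Up => (1, 1) | Hor => (1, 0) | Down => (1, -1) end.

(* The lattice point reached from (0,0) after the first i steps of p. *)
Definition path_point (p : seq step) (i : nat) : int * int :=
  \sum_(s <- take i p) step_vec s.

Definition is_motzkin (n : nat) (p : seq step) : bool :=
  (path_point p (size p) == (n%:Z, 0))
  && [forall i : 'I_(size p).+1, 0 <= (path_point p i).2].

(* A Motzkin path of length n has exactly n steps, each having abscissa 1. *)
Definition motzkin_paths (n m k : nat) : {set n.-tuple step} :=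
  [set p : n.-tuple step |
    [&& is_motzkin n p, count_mem Up p == m & count_mem Hor p == k]].

(* The steps of w at positions a, ..., a + i - 1 all equal x, and this run
   extends neither to the left nor to the right. *)
Definition is_segment (x : step) (w : seq step) (a i : nat) : bool :=
  [&& (a + i <= size w)%N,
      all (pred1 x) (take i (drop a w)),
      (0 < a)%N ==> (nth x w a.-1 != x)
    & (a + i < size w)%N ==> (nth x w (a + i) != x)].

(* Number of x-segments of length i of w, for i >= 1. *)
Definition nb_segments (x : step) (i : nat) (w : seq step) : nat :=
  #|[set a : 'I_(size w) | is_segment x w a i]|.

(* The weight of a path; there are no segments of length i > size w.
   The sequences t and s are used at indices i >= 1 only. *)
Definition segment_weight (R : comNzRingType) (t s : nat -> R) (w : seq step)
    : R :=
  (\prod_(1 <= i < (size w).+1) t i ^+ nb_segments Up i w)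
  * (\prod_(1 <= i < (size w).+1) s i ^+ nb_segments Hor i w).

(* a (a - 1) ... (a - b + 1) / b! if b >= 0, and 0 if b < 0. *)
Definition gbinom (K : numFieldType) (a : K) (b : int) : K :=
  match b with
  | Posz n => (\prod_(i < n) (a - i%:R)) / n`!%:R
  | Negz _ => 0
  end.

(* The partial Bell polynomial B_{n,r} evaluated at x 1, x 2, ...  The tuple
   (r_1, ..., r_n) is given by r_(i+1) = q i; every r_i <= n since
   i r_i <= n. *)
Definition bell (K : numFieldType) (R : comAlgType K) (n r : nat)
    (x : nat -> R) : R :=
  \sum_(q : {ffun 'I_n -> 'I_n.+1} |
          (\sum_(i < n) q i == r)%N && (\sum_(i < n) i.+1 * q i == n)%N)
    (n`!%:R / \prod_(i < n) (q i)`!%:R : K)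
    *: \prod_(i < n) ((i.+1)`!%:R^-1 *: x i.+1) ^+ q i.

(* The exponential generating function of f 1, f 2, ... (without constant
   term), up to degree N. *)
Definition egf_upto (K : numFieldType) (R : comAlgType K) (N : nat)
    (f : nat -> R) : {poly R} :=
  \sum_(1 <= j < N.+1) (j`!%:R^-1 *: f j)%:P * 'X^j.

(* The potential polynomial P_n^(lam) evaluated at f 1, f 2, ...: n! times the
   coefficient of u^n in (1 + F)^lam = \sum_i gbinom lam i F^i, where F is the
   exponential generating function of f.  As F has no constant term, only the
   indices i <= n and the terms of degree at most n of F contribute. *)
Definition potential (K : numFieldType) (R : comAlgType K) (n : nat) (lam : K)
    (f : nat -> R) : R :=
  n`!%:R * \sum_(i < n.+1) gbinom lam i *: (egf_upto n f ^+ i)`_n.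

Lemma gbinom_nat (K : numFieldType) (a b : nat) :
  gbinom (a%:R : K) b = 'C(a, b)%:R.
Proof.
have fb : b`!%:R != 0 :> K by rewrite pnatr_eq0 -lt0n fact_gt0.
apply: (mulIf fb); rewrite /gbinom mulfVK // -natrM bin_ffact.
elim: b {fb} => [|b IH]; first by rewrite big_ord0 ffactn0.
rewrite big_ord_recr /= IH ffactnSr natrM.
have [le_ba|lt_ab] := leqP b a; first by rewrite natrB.
by rewrite ffact_small // !mul0r.
Qed.

Lemma egf_upto_decomp (K : numFieldType) (R : comAlgType K) (n N : nat)
    (f : nat -> R) : (n <= N)%N ->
  exists g h : {poly R},
    egf_upto n f = g * 'X /\ egf_upto N f = egf_upto n f + h * 'X^(n.+1).
Proof.
move=> le_nN.
exists (\sum_(1 <= j < n.+1) (j`!%:R^-1 *: f j)%:P * 'X^(j.-1)).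
exists (\sum_(n.+1 <= j < N.+1) (j`!%:R^-1 *: f j)%:P * 'X^(j - n.+1)).
split.
  rewrite mulr_suml; apply: eq_big_nat => j /andP[j_gt0 _].
  by rewrite -mulrA -exprSr prednK.
rewrite /egf_upto (big_cat_nat _ (n := n.+1)) //=; congr (_ + _).
rewrite mulr_suml; apply: eq_big_nat => j /andP[lt_nj _].
by rewrite -mulrA -exprD subnK.
Qed.

(* For natural exponents, the defining identity of the potential polynomials
   holds modulo u^(N+1), for every N, with an ordinary power on the right. *)
Lemma potential_natE (K : numFieldType) (R : comAlgType K) (n N a : nat)
    (f : nat -> R) : (n <= N)%N ->
  potential n (a%:R : K) f = n`!%:R * ((1 + egf_upto N f) ^+ a)`_n.
Proof.
move=> le_nN; rewrite /potential; congr (_ * _).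
have [g [h [Eg Eh]]] := egf_upto_decomp f le_nN.
have -> : ((1 + egf_upto N f) ^+ a)`_n = ((1 + egf_upto n f) ^+ a)`_n.
  rewrite Eh addrA exprDn big_ord_recl /= subn0 expr0 mulr1 bin0 mulr1n.
  rewrite coefD [X in _ + X](_ : _ = 0) ?addr0 // coef_sum big1 // => i _.
  rewrite coefMn /bump /= add1n exprMn -exprM mulrA coefMXn.
  by rewrite mulnC mulSn ltnS leq_addr mul0rn.
pose c i := ((egf_upto n f) ^+ i)`_n *+ 'C(a, i).
have -> : ((1 + egf_upto n f) ^+ a)`_n = \sum_(i < a.+1) c i.
  rewrite exprDn coef_sum; apply: eq_bigr => i _.
  by rewrite coefMn expr1n mul1r.
have -> : \sum_(i < n.+1) gbinom a%:R i *: (egf_upto n f ^+ i)`_n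
          = \sum_(i < n.+1) c i.
  by apply: eq_bigr => i _; rewrite gbinom_nat scaler_nat.
have c0 i : (n < i)%N || (a < i)%N -> c i = 0.
  rewrite /c => /orP[lt_ni|lt_ai]; last by rewrite bin_small.
  by rewrite Eg exprMn coefMXn lt_ni mul0rn.
pose M := (n + a).+1.
have widen b : (b < M)%N -> (forall i, (b < i)%N -> c i = 0) ->
    \sum_(i < b.+1) c i = \sum_(i < M) c i.
  move=> lt_bM cb0; rewrite -!(big_mkord xpredT c) [RHS](big_cat_nat _ (n := b.+1)) //=.
  by rewrite [X in _ + X]big_nat [X in _ + X]big1 ?addr0 // => i /andP[/cb0].
rewrite !widen ?/M ?ltnS ?leq_addr ?leq_addl // => i lt_i; apply: c0.
  by rewrite lt_i orbT.
by rewrite lt_i.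
Qed.

(* Main.v *)
Require Import Defs.
From mathcomp Require Import all_boot all_order all_algebra.
From mathcomp Require Import ring zify.

Set Implicit Arguments.
Unset Strict Implicit.
Unset Printing Implicit Defensive.
Import GRing.Theory Num.Theory.
Local Open Scope ring_scope.

(* Cut a path at its down-steps into blocks, i.e. words over {Up, Hor}.  Let u
   mark up-steps and v horizontal steps, and put T = 1 + \sum_i t_i u^i and
   S = \sum_i s_i v^i.  Sorting the words by their alternating runs, the blocks
   have the generating function Phi = T (1 + S) / (1 - (T - 1) S).  By the
   ballot theorem the paths with m down-steps are counted by
   [u^m] Phi^(m+1) / (m + 1); instead of cyclic shifts, the proof guesses the
   generating function of the suffixes of paths that start at height h with a
   given current run, and checks it by induction, removing one step at a time.
   For a up-steps to come, put c = h + a, which no up-step changes; a suffix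
   that is empty or starts with a down-step is then counted by [u^a] E_c, where
   E_0 = 1 and E_c = Phi^(c-1) (Phi - u Phi'), since
   [u^a] E_c = (c - a) / c [u^a] Phi^c.
   Finally, Phi^M is expanded in powers of S by a recurrence on M, and
   [v^k] S^l is a Bell polynomial by the multinomial theorem. *)

(** * Paths as words *)

Lemma big_step (V : nmodType) (F : step -> V) :
  \sum_(x : step) F x = F Up + F Hor + F Down.
Proof.
rewrite (bigD1 Up) //= (bigD1 Hor) //= (bigD1 Down) //= big1 ?addr0 ?addrA //.
by case.
Qed.

Lemma big_tupleS (V : nmodType) (T : finType) (n : nat) (P : pred (seq T))
    (F : seq T -> V) :
  \sum_(w : n.+1.-tuple T | P w) F w
  = \sum_(x : T) \sum_(w : n.-tuple T | P (x :: w)) F (x :: w).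
Proof.
rewrite pair_big_dep /=.
rewrite (reindex (fun xw : T * n.-tuple T => [tuple of xw.1 :: xw.2])) //=.
exists (fun w : n.+1.-tuple T => (thead w, [tuple of behead w]))
  => [[x w] _|w _] /=.
  by rewrite theadE; congr (_, _); apply: val_inj.
by rewrite -tuple_eta.
Qed.

Fixpoint descends (h : nat) (w : seq step) : bool :=
  match w with
  | [::] => h == 0%N
  | Up :: w' => descends h.+1 w'
  | Hor :: w' => descends h w'
  | Down :: w' => if h is h'.+1 then descends h' w' else false
  end.

Lemma path_point_cons x w i :
  path_point (x :: w) i.+1 = step_vec x + path_point w i.
Proof. by rewrite /path_point /= big_cons. Qed.

Lemma path_point0 w : path_point w 0 = 0.
Proof. by rewrite /path_point take0 big_nil. Qed.

Lemma descendsE h w :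
  descends h w = (h%:Z + (path_point w (size w)).2 == 0)
    && [forall i : 'I_(size w).+1, 0 <= h%:Z + (path_point w i).2].
Proof.
have consE x v g : [forall i : 'I_(size (x :: v)).+1,
      0 <= g%:Z + (path_point (x :: v) i).2]
    = [forall i : 'I_(size v).+1,
        0 <= g%:Z + (step_vec x).2 + (path_point v i).2].
  apply/forallP/forallP => /= H i.
    by have := H (lift ord0 i); rewrite lift0 path_point_cons addrA.
  case: (unliftP ord0 i) => [j ->|->]; last by rewrite path_point0 addr0.
  by have := H j; rewrite lift0 path_point_cons addrA.
elim: w h => [|x w IH] h.
  rewrite /= path_point0 /=; apply/idP/andP => [/eqP->|[/eqP]].
    by split=> //; apply/forallP => i; rewrite ord1 path_point0.
  by rewrite addr0 => -[->].
rewrite consE [size _]/= path_point_cons addrA.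
case: x => /=; first by rewrite IH -(addn1 h) PoszD.
  by rewrite IH addr0.
case: h => [|h]; last by rewrite IH -(addn1 h) PoszD addrK.
apply/esym/negP => /andP[_ /forallP/(_ ord0)].
by rewrite path_point0.
Qed.

Lemma path_point_size w : (path_point w (size w)).1 = (size w)%:Z.
Proof.
elim: w => [|x w IH]; first by rewrite path_point0.
by rewrite [size _]/= path_point_cons /= IH; case: x.
Qed.

Lemma is_motzkinE w : is_motzkin (size w) w = descends 0 w.
Proof.
rewrite descendsE /is_motzkin add0r -[in LHS]path_point_size.
rewrite -pair_eqE /= eqxx /=; congr (_ && _).
by apply: eq_forallb => i; rewrite add0r.
Qed.

Lemma size_descends h w : descends h w ->
  size w = (h + 2 * count_mem Up w + count_mem Hor w)%N.
Proof.
elim: w h => [|x w IH] h /=; first by move/eqP->.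
case: x; last case: h => // h.
- by move/IH->; rewrite !eqE /=; lia.
- by move/IH->; rewrite !eqE /=; lia.
- by move/IH->; rewrite !eqE /=; lia.
Qed.

(** * Weights by runs *)

Lemma nb_segmentsE x i w :
  nb_segments x i w = (\sum_(a < size w) is_segment x w a i)%N.
Proof.
rewrite /nb_segments -sum1_card.
rewrite (eq_bigl (fun a : 'I_(size w) => is_segment x w a i)).
  by rewrite big_mkcond; apply: eq_bigr => a _; case: ifP.
by move=> a; rewrite inE.
Qed.

Lemma nth_is_segment x0 x w a i b : is_segment x w a i -> (b < i)%N ->
  nth x0 w (a + b) = x.
Proof.
case/and4P=> le_w /(all_nthP x0) H _ _ lt_bi.
have /H : (b < size (take i (drop a w)))%N.
  by rewrite size_take size_drop; case: ifP => _; lia.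
by rewrite nth_take // nth_drop => /eqP.
Qed.

(** Only a = 0 needs care, where w gains the left neighbour x. A nonempty z-segment at the front of
    w makes z the head of w, hence different from x. *)
Lemma is_segment_shift x j w z a i : (0 < i)%N -> ohead w != Some x ->
  is_segment z (nseq j x ++ w) (j + a) i = is_segment z w a i.
Proof.
move=> i_gt0 hw; rewrite /is_segment size_cat size_nseq -addnA.
have nthE b : nth z (nseq j x ++ w) (j + b) = nth z w b.
  by rewrite nth_cat size_nseq ltnNge leq_addr addKn.
have dropE : drop (j + a) (nseq j x ++ w) = drop a w.
  rewrite drop_cat size_nseq ltnNge leq_addr addKn //.
rewrite leq_add2l ltn_add2l nthE dropE.
case: a {dropE} => [|a]; last by rewrite addnS /= nthE.
rewrite addn0 add0n drop0 /=.
have [le_iw|//] := leqP i (size w); case: (altP allP) => //= allz.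
suff -> : (0 < j)%N ==> (nth z (nseq j x ++ w) j.-1 != z) by [].
case: j nthE => // j _ /=.
have -> : nth z (x :: nseq j x ++ w) j = x.
  by rewrite -cat_cons nth_cat /= size_nseq ltnSn (nth_nseq z j.+1) ltnSn.
case: w i i_gt0 le_iw allz hw => [|y w] [|i] //= _ _ /(_ y).
rewrite inE eqxx => /(_ isT) /eqP -> hw.
by apply: contra_neq hw => ->.
Qed.

(** Inside the leading run only position 0 can start a segment: every later position has x itself on
    its left. *)
Lemma nb_segments_run x j w z i : (0 < j)%N -> (0 < i)%N ->
    ohead w != Some x ->
  nb_segments z i (nseq j x ++ w)
  = (((z == x) && (i == j)) + nb_segments z i w)%N.
Proof.
move=> j_gt0 i_gt0 hw; rewrite !nb_segmentsE size_cat size_nseq.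
rewrite big_split_ord /=; congr (_ + _)%N; last first.
  by apply: eq_bigr => a _; rewrite is_segment_shift.
have nthx b : (b < j)%N -> nth x (nseq j x ++ w) b = x.
  by move=> lt_bj; rewrite nth_cat size_nseq lt_bj nth_nseq lt_bj.
case: j j_gt0 nthx => // j _ nthx.
rewrite big_ord_recl /= big1 ?addn0 => [|a _].
  congr nat_of_bool.
  have [?|neq_zx] /= := eqVneq z x; last first.
    apply/negP => /(nth_is_segment x) /(_ i_gt0) /= zx.
    by rewrite zx eqxx in neq_zx.
  subst z; have hw' : (0 < size w)%N -> nth x (x :: nseq j x ++ w) j.+1 != x.
    rewrite -cat_cons nth_cat /= size_nseq ltnn subnn.
    by case: (w) hw => //= y w' yx _; apply: contra_neq yx => ->.
  have [->|neq_ij] := eqVneq i j.+1.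
    rewrite /is_segment -(cat_cons x) (drop0 (_ ++ _)) add0n
      size_cat /= size_nseq.
    rewrite leq_addr take_size_cat /= ?size_nseq // eqxx
      all_nseq /= eqxx orbT /=.
    rewrite -[X in (X < _)%N]addn0 ltn_add2l.
    by apply/implyP => /hw'.
  apply/negP => seg.
  have := nth_is_segment x seg; have /and4P[le_i _ _ /implyP] := seg.
  rewrite /= size_cat size_nseq add0n in le_i * => lt_i nthz.
  have [lt_ij|le_ji] := ltnP i j.+1.
    by have := lt_i (leq_trans lt_ij (leq_addr _ _)); rewrite nthx ?eqxx.
  have lt_ji : (j.+1 < i)%N by rewrite ltn_neqAle eq_sym neq_ij.
  have /eqP := nthz _ lt_ji; rewrite add0n (negPf (hw' _)) //.
  by rewrite -(ltn_add2l j.+1) addn0 (leq_trans lt_ji).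
apply/eqP; rewrite eqb0; apply/negP => seg.
have := nth_is_segment x seg i_gt0.
rewrite addn0 /bump add1n nthx ?ltnS // => zx.
have /and4P[_ _ /implyP/(_ isT)] := seg.
by rewrite /bump add1n -pred_Sn -zx nthx ?eqxx // ltnS ltnW.
Qed.

Definition run_coef (R : comNzRingType) (t s : nat -> R) (x : step) (i : nat)
    : R :=
  match x with Up => t i | Hor => s i | Down => 1 end.

(* The weight of x^i w, when the i steps x are followed by w. *)
Fixpoint run_weight (R : comNzRingType) (t s : nat -> R) (x : step) (i : nat)
    (w : seq step) : R :=
  if w is y :: w' then
    if y == x then run_weight t s x i.+1 w'
    else run_coef t s x i * run_weight t s y 1 w'
  else run_coef t s x i.

Lemma run_weight_nseq (R : comNzRingType) (t s : nat -> R) x i j w :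
    ohead w != Some x ->
  run_weight t s x i (nseq j x ++ w)
  = run_coef t s x (i + j) * run_weight t s Down 0 w.
Proof.
elim: j i => [|j IH] i hw; last by rewrite /= eqxx IH // addSnnS.
rewrite addn0; case: w hw => [|y w] /=; first by rewrite mulr1.
move=> /eqP hw; have /eqP/negPf-> : y <> x by move=> yx; apply: hw; rewrite yx.
(* The length of a current [Down] run never matters, as its coefficient is 1; so [Down] with length
   0 acts as an empty prefix. *)
have /= H n : run_weight t s Down n w = run_weight t s Down 0 w.
  by elim: (w) n => //= z v IH n; case: ifP => // _; rewrite IH [RHS]IH.
by case: eqP => [->|_]; rewrite ?mul1r // H -(H 1).
Qed.

Lemma run_decomp (T : eqType) (x : T) (w : seq T) :
  exists j v, w = nseq j x ++ v /\ ohead v != Some x.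
Proof.
elim: w => [|y w [j [v [-> hv]]]]; first by exists 0%N, [::].
have [->|neq_yx] := eqVneq y x; first by exists j.+1, v.
by exists 0%N, (y :: nseq j x ++ v).
Qed.

Lemma segment_weightE (R : comNzRingType) (t s : nat -> R) w :
  segment_weight t s w = run_weight t s Down 0 w.
Proof.
(* The bound of the products becomes a fixed B, so that it survives the strong induction, which
   removes a whole run at a time. *)
rewrite /segment_weight; move: {-1}(size w) (leqnn (size w)) => B.
have [n le_wn] := ubnP (size w); elim: n => // n IH in w le_wn *.
case: w le_wn => [|x w] le_wn leB.
  have nil_ z i : nb_segments z i [::] = 0%N by rewrite nb_segmentsE big_ord0.
  by rewrite !big1 ?mulr1 // => i _; rewrite nil_.
have [j [v [Ew hv]]] := run_decomp x w.
have Exw : x :: w = nseq j.+1 x ++ v by rewrite Ew.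
have sz : (size (x :: w) = j.+1 + size v)%N by rewrite Exw size_cat size_nseq.
have -> : run_weight t s Down 0 (x :: w)
          = run_coef t s x j.+1 * run_weight t s Down 0 v.
  rewrite /=; case: eqP => [xD|_]; last first.
    by rewrite mul1r Ew run_weight_nseq.
  by rewrite Ew xD run_weight_nseq -xD.
rewrite -IH; last 2 first.
- move: le_wn; rewrite sz ltnS; apply: leq_trans.
  by rewrite addSn ltnS leq_addl.
- by move: leB; rewrite sz; apply: leq_trans; rewrite leq_addl.
have segE z (f : nat -> R) :
    \prod_(1 <= i < B.+1) f i ^+ nb_segments z i (x :: w)
    = (if z == x then f j.+1 else 1)
      * \prod_(1 <= i < B.+1) f i ^+ nb_segments z i v.
  have -> : (if z == x then f j.+1 else 1)
      = \prod_(1 <= i < B.+1) f i ^+ ((z == x) && (i == j.+1)).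
    case: eqP => _; last by rewrite big1.
    have lt_jB : (j < B)%N.
      by move: leB; rewrite sz; apply: leq_trans; rewrite leq_addr.
    rewrite (bigD1_seq j.+1) ?mem_index_iota ?iota_uniq //= eqxx big1 ?mulr1 //.
    by move=> i /negPf ->.
  rewrite -big_split; apply: eq_big_nat => i /andP[i_gt0 _].
  by rewrite Exw nb_segments_run // exprD.
rewrite !segE; case: (x) => /=; ring.
Qed.

(** * Generating functions of path suffixes *)

Lemma mulrn_comAlg_eq0 (K : numFieldType) (R : comAlgType K) (x : R) (n : nat) :
  x *+ n.+1 = 0 -> x = 0.
Proof.
have nz : n.+1%:R != 0 :> K by rewrite pnatr_eq0.
by rewrite -scaler_nat => /(canRL (scalerK nz)); rewrite scaler0.
Qed.

(** For a run that already has i steps: the variable marks the steps still to be added, and f weighs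
    the final length, at most N. *)
Definition tail_series (Q : comNzRingType) (f : nat -> Q) (N i : nat)
    : {poly Q} := \sum_(i <= j < N.+1) (f j)%:P * 'X^(j - i).

Lemma tail_seriesS (Q : comNzRingType) (f : nat -> Q) N i : (i <= N)%N ->
  tail_series f N i = (f i)%:P + 'X * tail_series f N i.+1.
Proof.
move=> le_iN; rewrite /tail_series big_ltn // subnn mulr1; congr (_ + _).
rewrite mulr_sumr; apply: eq_big_nat => j /andP[lt_ij _].
by rewrite mulrCA -exprS -subSn.
Qed.

Section Suffixes.

Variables (K : numFieldType) (R : comAlgType K) (t s : nat -> R) (N k0 : nat).

Notation A := {poly {poly R}}.

(** The outer variable of [A] is u, marking up-steps, and [v] marks horizontal steps. *)
Let v : A := 'X%:P.
Let Tail i : A := tail_series (fun j => (t j)%:P) N i.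
Let Stail i : A := (tail_series s k0 i)%:P.

Definition up_runs : A := 'X * Tail 1.
Definition hor_runs : A := v * Stail 1.
(* The words over {Up, Hor} not starting with Up, and not starting with Hor; the
   geometric series is cut off at v^k0. *)
Definition not_up_gf : A :=
  (1 + hor_runs) * \sum_(i < k0.+1) (up_runs * hor_runs) ^+ i.
Definition not_hor_gf : A := 1 + up_runs * not_up_gf.
Definition block_gf : A := (1 + up_runs) * not_up_gf.

(** The ways to complete a run x^i up to the next down-step or the end, including the weight of that
    run. After a down-step a whole block follows, whatever i is. *)
Definition run_gf (x : step) (i : nat) : A :=
  match x with
  | Up => Tail i * not_up_gf
  | Hor => Stail i * not_hor_gf
  | Down => block_gf
  end.

Definition down_gf (c : nat) : A :=
  if c is b.+1 then block_gf ^+ b * (block_gf - 'X * block_gf^`()) else 1.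

(** The ballot factor (c - a) / c with c = b + 1, cleared of denominators: the operator u d/du
    multiplies the coefficient of u^a by a. *)
Lemma coef_down_gf b a :
  (down_gf b.+1)`_a *+ b.+1
  = (block_gf ^+ b.+1)`_a *+ b.+1 - (block_gf ^+ b.+1)`_a *+ a.
Proof.
have -> : (block_gf ^+ b.+1)`_a *+ a = ('X * (block_gf ^+ b.+1)^`())`_a.
  by case: a => [|a]; rewrite mulrC coefMX //= coef_deriv.
rewrite -!coefMn -coefB deriv_exp.
have <- // : down_gf b.+1 *+ b.+1 = block_gf ^+ b.+1 *+ b.+1
    - 'X * (block_gf^`() * block_gf ^+ b *+ b.+1).
rewrite /down_gf exprS; ring.
Qed.

(** For h + a > 0 this is an identity of polynomials. For h = a = 0 only the constant term in u is
    compared, and there the derivative term vanishes. *)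
Lemma down_gf_step h a k :
  (down_gf (h.+1 + a))`_a`_k = (block_gf * down_gf (h + a))`_a`_k.
Proof.
rewrite addSn /=; case hac: (h + a)%N => [|c].
  have -> : a = 0%N by lia.
  by rewrite mul1r mulr1 coefB coefXM subr0.
by rewrite exprS mulrA.
Qed.

(** At height 0 no down-step is possible, so only the empty suffix remains; algebraically, c = a
    makes the ballot factor zero. *)
Lemma down_gf_zero a k : (down_gf a)`_a`_k = ((a == 0) && (k == 0))%:R.
Proof.
case: a => [|a]; first by rewrite coef1 /= coef1; case: k.
apply: (@mulrn_comAlg_eq0 _ _ _ a).
by rewrite -coefMn coef_down_gf subrr coef0.
Qed.

(** A word not starting with [Up] is empty or starts with a run of [Hor]. Cutting off the geometric
    series costs a multiple of v^(k0+1). *)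
Lemma not_up_gfE : exists g,
  not_up_gf = 1 + hor_runs * not_hor_gf + v ^+ k0.+1 * g.
Proof.
exists (- (1 + hor_runs) * (up_runs * Stail 1) ^+ k0.+1).
have := subrX1 (up_runs * hor_runs) k0.+1.
rewrite /not_hor_gf /not_up_gf; set p := \sum_(_ < _) _ => Hp.
have -> : v ^+ k0.+1 * (- (1 + hor_runs) * (up_runs * Stail 1) ^+ k0.+1)
    = - (1 + hor_runs) * (up_runs * hor_runs) ^+ k0.+1.
  by rewrite mulrCA -exprMn [v * (_ * _)]mulrCA.
have -> : (up_runs * hor_runs) ^+ k0.+1 = 1 + (up_runs * hor_runs - 1) * p.
  by rewrite -Hp; ring.
ring.
Qed.

Lemma coef_hor_trunc (p : A) a k : (k <= k0)%N -> (v ^+ k0.+1 * p)`_a`_k = 0.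
Proof. by move=> le_k; rewrite -rmorphXn coefCM coefXnM ltnS le_k. Qed.

Lemma coef_up (p : A) a k :
  ('X * p)`_a`_k = if a is a'.+1 then p`_a'`_k else 0.
Proof. by rewrite coefXM; case: a => //=; rewrite coef0. Qed.

Lemma coef_hor (p : A) a k :
  (v * p)`_a`_k = if k is k'.+1 then p`_a`_k' else 0.
Proof. by rewrite coefCM coefXM; case: k. Qed.

(* The suffixes of length n starting at height h, preceded by a run x^i. *)
Definition suffix_sum n x i h k : R :=
  \sum_(w : n.-tuple step | descends h w && (count_mem Hor w == k))
    run_weight t s x i w.

Lemma suffix_sumS n x i h k :
  suffix_sum n.+1 x i h k =
    let next y h' k' := if y == x then suffix_sum n x i.+1 h' k'
      else run_coef t s x i * suffix_sum n y 1 h' k' in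
    next Up h.+1 k
    + (if k is k'.+1 then next Hor h k' else 0)
    + (if h is h'.+1 then next Down h' k else 0).
Proof.
rewrite /suffix_sum.
rewrite (big_tupleS _ (fun w => descends h w && (count_mem Hor w == k))).
have nextE y h' k' (P : pred (n.-tuple step)) :
    P =1 (fun w => descends h' w && (count_mem Hor w == k')) ->
    \sum_(w : n.-tuple step | P w) run_weight t s x i (y :: w)
    = if y == x then suffix_sum n x i.+1 h' k'
      else run_coef t s x i * suffix_sum n y 1 h' k'.
  move=> EP; rewrite (eq_bigl _ _ EP) /=; case: ifP => // _.
  by rewrite /suffix_sum mulr_sumr.
rewrite big_step /=; congr (_ + _ + _).
- exact: nextE.
- case: k nextE => [|k] nextE; last exact: nextE.
  by rewrite big_pred0 // => w; rewrite andbF.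
- by case: h nextE => [|h] nextE; [rewrite big_pred0|exact: nextE].
Qed.

Lemma suffix_sum_eq0 n x i h k : (n < h + k)%N -> suffix_sum n x i h k = 0.
Proof.
move=> lt_n; rewrite /suffix_sum big1 // => w /andP[/size_descends].
by rewrite size_tuple => En /eqP Ek; exfalso; move: lt_n En; rewrite Ek; lia.
Qed.

Lemma coef_congr (p q g : A) a k : (k <= k0)%N -> p = q + v ^+ k0.+1 * g ->
  q`_a`_k = p`_a`_k.
Proof. by move=> le_k ->; rewrite 2!coefD coef_hor_trunc // addr0. Qed.

(** Induction on n by the first step. The last hypothesis keeps the current run within the
    truncation even if all remaining steps of its kind extend it. *)
Lemma suffix_sumE n x i h a k : n = (h + 2 * a + k)%N ->
    (k <= k0)%N -> (a <= N)%N ->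
    (match x with Up => i + a <= N | Hor => i + k <= k0 | Down => true end)%N ->
  suffix_sum n x i h k = (run_gf x i * down_gf (h + a))`_a`_k.
Proof.
have [g not_up_eq] := not_up_gfE.
elim: n x i h a k => [|n IH] x i h a k En le_kk0 le_aN le_xN.
  have [-> -> ->] : [/\ h = 0, a = 0 & k = 0]%N by split; lia.
  have not_up0 : not_up_gf`_0`_0 = 1.
    rewrite not_up_eq /hor_runs -!mulrA exprS -mulrA !coefD coef1 !coef_hor.
    by rewrite coef1 !addr0.
  have not_hor0 : not_hor_gf`_0`_0 = 1.
    by rewrite /not_hor_gf /up_runs -mulrA !coefD coef_up addr0 coef1 coef1.
  rewrite /suffix_sum (big_pred1 [tuple]) => [|w]; last by rewrite tuple0.
  rewrite mulr1 /=; case: x le_xN => le_iN /=.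
  - rewrite coef0M coef0M not_up0 mulr1 /Tail tail_seriesS; last by lia.
    by rewrite coefD coefC coefXM addr0 coefC.
  - rewrite coef0M coef0M not_hor0 mulr1 /Stail coefC tail_seriesS; last by lia.
    by rewrite coefD coefXM coefC addr0.
  by rewrite /block_gf /up_runs coef0M coef0M not_up0 mulr1 !coefD coef_up
    addr0 coef1 coef1.
rewrite suffix_sumS.
(* An up-step turns (h, a) into (h + 1, a - 1): h + a is kept and a factor u is gained. *)
have upE j : (a = 0 \/ j + a <= N.+1)%N ->
    suffix_sum n Up j h.+1 k = ('X * (run_gf Up j * down_gf (h + a)))`_a`_k.
  rewrite coef_up; case: a En le_aN {le_xN} => [|a] En le_aN le_ja.
    by rewrite suffix_sum_eq0 //; lia.
  by rewrite (IH _ _ _ a) ?addSnnS //; lia.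
have horE j : (k = 0 \/ j + k <= k0.+1)%N ->
    (if k is k'.+1 then suffix_sum n Hor j h k' else 0)
    = (v * (run_gf Hor j * down_gf (h + a)))`_a`_k.
  rewrite coef_hor; case: k En le_kk0 {le_xN upE} => [|k] En le_kk0 le_jk //.
  by rewrite (IH _ _ _ a) //; lia.
(* At h = 0 the right side vanishes by [down_gf_zero], since the suffix is nonempty and so a or k is
   positive. *)
have downE j : (if h is h'.+1 then suffix_sum n Down j h' k else 0)
    = (down_gf (h + a))`_a`_k.
  case: h En {upE horE} => [|h] En.
    by rewrite down_gf_zero; case: eqP => //= ?; case: eqP => //= ?; lia.
  by rewrite down_gf_step // (IH _ _ _ a) //; lia.
have scale c (p : A) : c * p`_a`_k = (c%:P%:P * p)`_a`_k by rewrite !coefCM.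
have mul_if c (b : nat) (f : nat -> R) :
    (if b is b'.+1 then c * f b' else 0) = c * (if b is b'.+1 then f b' else 0).
  by case: b => //; rewrite mulr0.
have fresh_up := upE 1%N; have fresh_hor := horE 1%N.
have fresh_down := downE 1%N.
(* For [Up] and [Hor] the next step extends the run or closes it with its coefficient, as in
   [tail_seriesS]; for [Down] the block is split by its first letter. Both sides agree up to a
   multiple of v^(k0+1). *)
case: x le_xN => le_xN; rewrite /= ?mul_if ?fresh_up ?fresh_hor ?fresh_down
  ?upE ?horE ?downE; try lia.
- rewrite !scale -!coefD.
  apply: (coef_congr (g := (t i)%:P%:P * g * down_gf (h + a))) => //=.
  rewrite /Tail tail_seriesS; last by lia.
  by rewrite mulrDl {1}not_up_eq /hor_runs; ring.
- rewrite !scale -!coefD.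
  apply: (coef_congr (g := 0)) => //=.
  rewrite /Stail tail_seriesS; last by lia.
  rewrite polyCD polyCM /not_hor_gf /up_runs /v; ring.
- rewrite !mul1r -!coefD.
  apply: (coef_congr (g := g * down_gf (h + a))) => //=.
  rewrite {1}/block_gf mulrDl mul1r {1}not_up_eq /up_runs /hor_runs; ring.
Qed.
End Suffixes.

(** * Powers of the block series *)

(* The absolute value of the coefficient of S^l in (S / (1 + S))^j, that is
   binom (l - 1) (l - j), where binom (-1) 0 = 1. *)
Definition shift_bin (l j : nat) : nat :=
  match l, j with
  | 0, _ => j == 0
  | l'.+1, 0 => 0
  | l'.+1, j'.+1 => 'C(l', j')
  end.

Lemma shift_binS l j :
  shift_bin l.+1 j.+1 = (shift_bin l j.+1 + shift_bin l j)%N.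
Proof. by case: l j => [|l] [|j] //=; rewrite ?bin0 ?binS. Qed.

Lemma shift_bin_small l j : (l < j)%N -> shift_bin l j = 0%N.
Proof. by case: l j => [|l] [|j] //= lt_lj; rewrite bin_small. Qed.

Section PowerExpansion.

Variables (A : comNzRingType) (T S : A).

(* The coefficient of S^l in (T (1 + S) / (1 - (T - 1) S))^M, which is
   T^M / (1 - T S / (1 + S))^M. *)
Definition block_coef (M l : nat) : A :=
  \sum_(j < l.+1)
    ((-1) ^+ (l + j) *+ (shift_bin l j * 'C((M + j).-1, j))) * T ^+ (M + j).

(** Compares coefficients of S^(l+1) in (1 - (T - 1) S) Phi^(M+1) = T (1 + S) Phi^M. *)
Lemma block_coefS M l :
  block_coef M.+1 l.+1
  = (T - 1) * block_coef M.+1 l + T * (block_coef M l.+1 + block_coef M l).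
Proof.
(* All sums are aligned on the powers T^(M+2+j) with j <= l; there the claim is Pascal's rule for
   both binomials. *)
have widen M' : block_coef M' l = \sum_(j < l.+2)
    ((-1) ^+ (l + j) *+ (shift_bin l j * 'C((M' + j).-1, j))) * T ^+ (M' + j).
  by rewrite big_ord_recr /= shift_bin_small // mul0n mulr0n mul0r addr0.
have shift : T * block_coef M.+1 l = \sum_(j < l.+1)
    ((-1) ^+ (l + j) *+ (shift_bin l j * 'C(M + j, j))) * T ^+ (M.+1 + j.+1).
  by rewrite mulr_sumr; apply: eq_bigr => j _; rewrite addnS exprS; ring.
rewrite mulrBl mul1r shift (widen M.+1) (widen M) mulrDr !mulr_sumr /block_coef.
rewrite ![\sum_(_ < l.+2) _]big_ord_recl /=.
set L := \sum_(_ < _) _; set a := \sum_(_ < _) _; set b := \sum_(_ < _) _.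
set c := \sum_(_ < _) _; set d := \sum_(_ < _) _.
have -> : L = a - b + (c + d).
  rewrite -sumrB -!big_split; apply: eq_bigr => j _ /=.
  have := shift_binS l j; rewrite /bump /= !add1n add0n => ->.
  rewrite !addnS !addSn /= binS !exprS !exprD; ring.
rewrite !addn0 !bin0 !exprS; ring.
Qed.

Lemma block_coef0 M : block_coef M 0 = T ^+ M.
Proof.
by rewrite /block_coef big_ord_recl big_ord0 addr0 /= !addn0 bin0 mul1r.
Qed.

Lemma block_coefM0 l : block_coef 0 l = (l == 0%N)%:R.
Proof.
case: l => [|l]; first by rewrite block_coef0.
rewrite /block_coef big1 // => -[[|j] lt_j] _ /=; first by rewrite mul0r.
by rewrite add0n /= [X in (_ * X)%N]bin_small // muln0 mul0r.
Qed.

(** The geometric sum inverts 1 - (T - 1) S up to a multiple of S^(k0+1), so multiplying the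
    truncated recurrence [block_coefS] by it raises M by one. *)
Lemma block_expansion k0 M : exists g,
  (T * ((1 + S) * \sum_(i < k0.+1) ((T - 1) * S) ^+ i)) ^+ M
  = \sum_(l < k0.+1) block_coef M l * S ^+ l + g * S ^+ k0.+1.
Proof.
set G := \sum_(i < k0.+1) _; elim: M => [|M [g IH]].
  exists 0; rewrite mul0r addr0 big_ord_recl big1 ?addr0 => [|i _].
    by rewrite block_coefM0 mul1r.
  by rewrite block_coefM0 mul0r.
have HG : (1 - (T - 1) * S) * G = 1 - (T - 1) ^+ k0.+1 * S ^+ k0.+1.
  have H := subrX1 ((T - 1) * S) k0.+1.
  by rewrite -exprMn -[RHS]opprB H -/G; ring.
pose Psi m := \sum_(l < k0.+1) block_coef m l * S ^+ l.
(* [Lo m] is [S * Psi m] without its top term, which goes into the remainder. *)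
pose Lo m := \sum_(l < k0) block_coef m l * S ^+ l.+1.
have PsiE m : S * Psi m = Lo m + block_coef m k0 * S ^+ k0.+1.
  rewrite /Psi big_ord_recr mulrDr mulr_sumr /= mulrCA -exprS; congr (_ + _).
  by apply: eq_bigr => i _; rewrite mulrCA -exprS.
have PsiS : Psi M.+1 = (T - 1) * Lo M.+1 + T * (Psi M + Lo M).
  have recl m : Psi m = T ^+ m + \sum_(l < k0) block_coef m l.+1 * S ^+ l.+1.
    by rewrite /Psi big_ord_recl block_coef0 mulr1.
  rewrite !recl exprS -addrA mulrDr addrCA; congr (_ + _).
  rewrite /Lo -big_split !mulr_sumr -big_split; apply: eq_bigr => l _ /=.
  by rewrite block_coefS; ring.
(* The summands come from the top terms missing in [Lo], the tail of the geometric sum, and the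
   previous remainder. *)
exists (G * ((T - 1) * block_coef M.+1 k0 + T * block_coef M k0)
  - Psi M.+1 * (T - 1) ^+ k0.+1 + T * (1 + S) * G * g).
set X := S ^+ k0.+1 in IH HG PsiE *.
rewrite exprS IH -/(Psi M) -/(Psi M.+1).
have E1 : T * (Psi M + S * Psi M) = Psi M.+1 * (1 - (T - 1) * S)
    + ((T - 1) * block_coef M.+1 k0 + T * block_coef M k0) * X.
  have -> : Psi M.+1 * (1 - (T - 1) * S) = Psi M.+1 - (T - 1) * (S * Psi M.+1).
    by ring.
  by rewrite !PsiE [in RHS]PsiS; ring.
have -> : T * ((1 + S) * G) * (Psi M + g * X)
    = G * (T * (Psi M + S * Psi M)) + T * (1 + S) * G * g * X by ring.
rewrite E1 mulrDr [G * (Psi _ * _)]mulrCA [G * (1 - _)]mulrC HG; ring.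
Qed.
End PowerExpansion.

(** * Bell polynomials *)

Section Multinomial.

Variables (A : comNzRingType) (ifact : nat -> A) (B : nat).
Hypothesis ifactP : forall c, c`!%:R * ifact c = 1.

Definition exp_trunc (y : A) : {poly A} :=
  \sum_(c < B.+1) (ifact c * y ^+ c)%:P * 'X^c.

Lemma coef_exp_trunc y l : (l <= B)%N -> (exp_trunc y)`_l = ifact l * y ^+ l.
Proof.
move=> le_lB; rewrite coef_sum (bigD1 (inord l)) //= coefCM coefXn inordK //.
rewrite eqxx mulr1 big1 ?addr0 // => c; rewrite coefCM coefXn eq_sym.
by rewrite -val_eqE /= inordK // => /negPf->; rewrite mulr0.
Qed.

Lemma ifact_bin l i : (i <= l)%N ->
  ifact l *+ 'C(l, i) = ifact i * ifact (l - i).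
Proof.
move=> le_il.
transitivity (ifact l *+ 'C(l, i) * (i`!%:R * ifact i)
  * ((l - i)`!%:R * ifact (l - i))); first by rewrite !ifactP !mulr1.
transitivity (l`!%:R * ifact l * (ifact i * ifact (l - i)));
  last by rewrite ifactP mul1r.
rewrite -(bin_fact le_il) !natrM; ring.
Qed.

(** Rests on exp(y X) exp(z X) = exp((y + z) X); the cut-off changes no coefficient of degree at
    most B. *)
Lemma coef_prod_exp_trunc (I : Type) (r : seq I) (y : I -> A) l :
  (l <= B)%N ->
  (\prod_(i <- r) exp_trunc (y i))`_l = ifact l * (\sum_(i <- r) y i) ^+ l.
Proof.
pose P (E : {poly A}) (z : A) :=
  forall l, (l <= B)%N -> E`_l = ifact l * z ^+ l.
suff: P (\prod_(i <- r) exp_trunc (y i)) (\sum_(i <- r) y i) by apply.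
apply: (big_ind2 P).
- move=> {}l _; rewrite coef1 expr0n; case: l => [|l]; last by rewrite mulr0.
  by have := ifactP 0; rewrite mul1r mulr1 => ->.
- move=> E1 z1 E2 z2 IH1 IH2 {}l le_lB.
  rewrite coefM addrC exprDn mulr_sumr; apply: eq_bigr => i _.
  have le_il : (i <= l)%N by rewrite -ltnS.
  rewrite IH1 ?IH2 ?(leq_trans (leq_subr _ _)) ?(leq_trans le_il) //.
  by rewrite mulrnAr -mulrnAl ifact_bin //; ring.
- by move=> i _ {}l; apply: coef_exp_trunc.
Qed.

Lemma multinomial (p : nat) (y : 'I_p -> A) l : (l <= B)%N ->
  ifact l * (\sum_i y i) ^+ l
  = \sum_(q : {ffun 'I_p -> 'I_B.+1} | (\sum_i q i)%N == l)
      \prod_i (ifact (q i) * y i ^+ q i).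
Proof.
move=> le_lB; rewrite -coef_prod_exp_trunc // /exp_trunc bigA_distr_bigA /=.
rewrite coef_sum [RHS]big_mkcond; apply: eq_bigr => q _.
rewrite big_split /= -rmorph_prod -expr_sum coefCM coefXn eq_sym.
by case: eqP; rewrite ?mulr1 ?mulr0.
Qed.

End Multinomial.

Section BellCoefficients.
Variables (K : numFieldType) (R : comAlgType K).
Implicit Types (t s : nat -> R).

Lemma fact_neq0 n : n`!%:R != 0 :> K.
Proof. by rewrite pnatr_eq0 -lt0n fact_gt0. Qed.

Lemma scale_fact n (x : R) : n`!%:R^-1 *: (n`!%:R * x) = x.
Proof. by rewrite mulr_natl -scaler_nat scalerK ?fact_neq0. Qed.

Lemma egf_upto_factE N s :
  egf_upto N (fun i => i`!%:R * s i) = \sum_(i < N) (s i.+1)%:P * 'X^(i.+1).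
Proof.
rewrite /egf_upto big_add1 big_mkord.
by apply: eq_bigr => i _; rewrite scale_fact.
Qed.

Lemma egf_upto_tail N s :
  egf_upto N (fun i => i`!%:R * s i) = 'X * tail_series s N 1.
Proof.
rewrite egf_upto_factE /tail_series mulr_sumr big_add1 big_mkord.
by apply: eq_bigr => i _; rewrite mulrCA -exprS subn1.
Qed.

(** The multinomial theorem for the terms s_i X^i: a choice q with sum l has degree equal to the sum
    of the i q_i, and degree k selects the terms of [bell]. Taking B = k gives q the type used
    there. *)
Lemma bell_coef s k l : (l <= k)%N ->
  (l`!%:R / k`!%:R : K) *: bell k l (fun i => i`!%:R * s i)
  = (egf_upto k (fun i => i`!%:R * s i) ^+ l)`_k.
Proof.
move=> le_lk; pose ifact c : {poly R} := ((c`!%:R^-1 : K)%:A)%:P.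
have ifactP c : c`!%:R * ifact c = 1.
  rewrite /ifact -polyC_natr -polyCM mulr_natl -scaler_nat scalerA.
  by rewrite divff ?fact_neq0 // scale1r.
have := multinomial ifactP (fun i : 'I_k => (s i.+1)%:P * 'X^(i.+1)) le_lk.
rewrite -egf_upto_factE /ifact => /(congr1 (fun p : {poly R} => p`_k)).
rewrite coefCM mulr_algl => Emul.
apply: (can_inj (scalerK (invr_neq0 (fact_neq0 l)))); rewrite Emul scalerA.
rewrite mulrA mulVf ?fact_neq0 // mul1r /bell scaler_sumr coef_sum.
rewrite big_mkcondr; apply: eq_bigr => q _.
have -> : \prod_(i < k) ((((q i)`!%:R^-1 : K)%:A : R)%:P
      * ((s i.+1)%:P * 'X^(i.+1)) ^+ q i)
    = (\prod_(i < k) ((q i)`!%:R^-1 : K) *: \prod_(i < k) s i.+1 ^+ q i)%:P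
      * 'X^(\sum_(i < k) i.+1 * q i).
  rewrite expr_sum -scaler_prod rmorph_prod -big_split.
  apply: eq_bigr => i _ /=.
  by rewrite exprMn -exprM -rmorphXn mulrA -polyCM mulr_algl.
rewrite coefCM coefXn eq_sym; case: eqP => _; last by rewrite mulr0.
rewrite mulr1 scalerA mulrA mulVf ?fact_neq0 // mul1r prodfV; congr (_ *: _).
by apply: eq_bigr => i _; rewrite scale_fact.
Qed.

(** For positive j this is the symmetry of binomials; l = 0 is the case binom (-1) 0 = 1. *)
Lemma gbinom_shift l j : (j <= l)%N ->
  gbinom (l%:R - 1 : K) (l%:Z - j%:Z) = (shift_bin l j)%:R.
Proof.
move=> le_jl; rewrite subzn //; case: l le_jl => [|l].
  by rewrite leqn0 => /eqP->; rewrite /gbinom big_ord0 fact0 divr1.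
rewrite -natr1 addrK gbinom_nat; case: j => [|j] le_jl /=.
  by rewrite bin_small.
by rewrite subSS bin_sub.
Qed.

End BellCoefficients.

(** * Assembly of the formula *)

Lemma motzkin_sumE (R : comNzRingType) (t s : nat -> R) m k n :
  n = (2 * m + k)%N ->
  \sum_(p in motzkin_paths n m k) segment_weight t s p
  = \sum_(w : n.-tuple step | descends 0 w && (count_mem Hor w == k))
      run_weight t s Down 0 w.
Proof.
move=> hn; apply: eq_big => [w|w _]; last exact: segment_weightE.
rewrite inE -{1}(size_tuple w) is_motzkinE.
have [/size_descends Ew|//] := boolP (descends 0 w).
rewrite /=; case: (count_mem Hor w =P k) => [Ek|_]; last by rewrite andbF.
(* The length and the number of horizontal steps determine the number of up-steps. *)
have /addIn/eqP : (0 + 2 * count_mem Up w + k = 2 * m + k)%N.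
  by rewrite -hn -Ek -Ew size_tuple.
by rewrite add0n eqn_pmul2l // andbT.
Qed.

(** Powers of T are free of v and powers of S are free of u, so each coefficient of u^m v^k splits
    into a product. *)
Lemma coef_block_gf_exp (K : numFieldType) (R : comAlgType K) (t s : nat -> R)
    m k M :
  (block_gf t s m k ^+ M)`_m`_k
  = \sum_(l < k.+1) \sum_(j < l.+1)
      ((-1) ^+ (l + j) *+ (shift_bin l j * 'C((M + j).-1, j)))
      * ((1 + egf_upto m (fun i => i`!%:R * t i)) ^+ (M + j))`_m
      * (egf_upto k (fun i => i`!%:R * s i) ^+ l)`_k.
Proof.
have [g Eg] := block_expansion (1 + up_runs t m) (hor_runs s k) k M.
rewrite [1 + up_runs t m - 1]addrC addKr in Eg.
rewrite /block_gf /not_up_gf Eg coefD coefD.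
have -> : (g * hor_runs s k ^+ k.+1)`_m`_k = 0.
  by rewrite /hor_runs exprMn mulrCA coef_hor_trunc.
rewrite addr0 !coef_sum; apply: eq_bigr => l _.
rewrite /block_coef mulr_suml !coef_sum; apply: eq_bigr => j _.
have -> : 1 + up_runs t m
    = map_poly polyC (1 + egf_upto m (fun i => i`!%:R * t i)).
  rewrite rmorphD rmorph1 egf_upto_factE /up_runs /tail_series mulr_sumr.
  congr (_ + _).
  rewrite big_add1 big_mkord rmorph_sum; apply: eq_bigr => i _ /=.
  by rewrite rmorphM /= map_polyC map_polyXn mulrCA -exprS subn1.
rewrite /hor_runs !egf_upto_tail -polyCM -!rmorphXn coefMC /=.
set c := (_ * _)%N.
have -> : (-1) ^+ (l + j) *+ c = ((-1) ^+ (l + j) *+ c)%:P%:P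
    :> {poly {poly R}} by rewrite !rmorphMn !rmorphXn !rmorphN1.
by rewrite coefCM coef_map -polyCM coefCM.
Qed.

Lemma exchange_triangle (V : nmodType) (F : nat -> nat -> V) k :
  \sum_(0 <= j < k.+1) \sum_(j <= l < k.+1) F j l
  = \sum_(l < k.+1) \sum_(j < l.+1) F j l.
Proof.
rewrite big_mkord; under eq_bigr => j _ do rewrite big_geq_mkord.
rewrite (exchange_big_dep xpredT) //=; apply: eq_bigr => l _.
by rewrite (big_ord_widen _ (fun j => F j l) (ltn_ord l)).
Qed.

Theorem theorem2p2 (K : numFieldType) (R : comAlgType K) (t s : nat -> R)
    (m k n : nat) (hn : n = (2 * m + k)%N) :
  \sum_(p in motzkin_paths n m k) segment_weight t s p
  = \sum_(0 <= j < k.+1) \sum_(j <= l < k.+1)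
      ((-1) ^+ (l - j) * gbinom (l%:R - 1 : K) (l%:Z - j%:Z)
        * gbinom ((m + j)%:R : K) j%:Z)
      *: (((m.+1)`!%:R^-1 : K)
            *: potential m ((m + j + 1)%:R : K) (fun i => i`!%:R * t i)
          * ((l`!%:R / k`!%:R : K) *: bell k l (fun i => i`!%:R * s i))).
Proof.
pose F j l : R := ((-1) ^+ (l - j) * gbinom (l%:R - 1 : K) (l%:Z - j%:Z)
        * gbinom ((m + j)%:R : K) j%:Z)
      *: (((m.+1)`!%:R^-1 : K)
            *: potential m ((m + j + 1)%:R : K) (fun i => i`!%:R * t i)
          * ((l`!%:R / k`!%:R : K) *: bell k l (fun i => i`!%:R * s i))).
rewrite -[RHS]/(\sum_(0 <= j < k.+1) \sum_(j <= l < k.+1) F j l).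
rewrite motzkin_sumE // -/(suffix_sum t s n Down 0 0 k).
rewrite (@suffix_sumE _ _ _ _ m k _ _ _ _ m) ?add0n //= -(add0n m).
(* A Motzkin path is what follows a down-step from height 1, hence c = m + 1. *)
rewrite -down_gf_step add1n.
have nz : m.+1%:R != 0 :> K by rewrite pnatr_eq0.
(* After multiplication by c = m + 1, the ballot factor is c - m = 1 and leaves the coefficient of
   Phi^(m+1). *)
apply: (can_inj (scalerK nz)); rewrite scaler_nat -coefMn add0n coef_down_gf.
rewrite mulrSr addrAC addrN add0r coef_block_gf_exp.
rewrite exchange_triangle scaler_sumr; apply: eq_bigr => l _.
rewrite scaler_sumr; apply: eq_bigr => j _.
have le_lk : (l <= k)%N by rewrite -ltnS.
have le_jl : (j <= l)%N by rewrite -ltnS.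
rewrite /F bell_coef // (gbinom_shift K le_jl) gbinom_nat.
rewrite (potential_natE _ _ (leqnn m)) addn1 addSn /=.
have sgn : (-1) ^+ (l + j) = (-1) ^+ (l - j) :> R.
  by rewrite -signr_odd -[RHS]signr_odd oddD oddB.
rewrite sgn; set P := ((1 + egf_upto m _) ^+ _)`_m.
set Q := (egf_upto k _ ^+ l)`_k.
have -> (x : K) a b : x * a%:R * b%:R = x *+ (a * b).
  by rewrite -mulrA -natrM mulr_natr.
have -> : m`!%:R * P = (m`!%:R : K) *: P by rewrite mulr_natl scaler_nat.
rewrite -!scalerAl !scalerA.
set c := (_ * _)%N.
have -> : (-1) ^+ (l - j) *+ c = ((-1) ^+ (l - j) *+ c : K)%:A :> R.
  by rewrite -[RHS]/(in_alg R _) rmorphMn rmorphXn rmorphN1.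
rewrite -mulrA mulr_algl; congr (_ *: _).
by rewrite factS natrM; field; rewrite fact_neq0 nat1r.
Qed.
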